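(* Let $n\ge3$. The minimum of $(\mathcal{E}_n,\preceq)$ is the diagram $\alpha_n$, with $\chi(\alpha_n)=\emptyset$, and the maximum is the diagram $\omega_n$, with $\chi(\omega_n)=S_n$. More generally, if $\epsilon,\epsilon'\in\mathcal{E}_n$ and $\epsilon'$ is obtained from $\epsilon$ by applying a straightening operator or a breaking operator, then $\epsilon\prec\epsilon'$ (i.e. $\epsilon\preceq\epsilon'$ and $\epsilon\ne\epsilon'$).
   Context: A plane branch is a reduced irreducible germ $(C,O)$ of complex analytic curve on a germ $(\mathcal{S},O)$ of smooth complex analytic surface. A model over $(\mathcal{S},O)$ is a composition of finitely many blow-ups of points above $O$. An infinitely near point of $O$ is a point lying over $O$ on some model, two such points being identified when the bimeromorphic map between the models is an isomorphism near them. $E(P)$ denotes the exceptional curve created by blowing up $P$, and also its strict transforms. $Q$ is proximate to $P$ if $Q\in E(P)$. A point $\neq O$ is free if it is proximate to exactly one point, and satellite if it is proximate to two. The minimal embedded resolution of $(C,O)$ is obtained by repeatedly blowing up the unique point where the total transform of $C$ is not a normal crossing. Let $P_0=O,P_1,\dots,P_{n-1}$ be the points blown up, in order; $n$ is the blow-up complexity of $C$ ($n=0$ if $C$ is smooth, $n\ge3$ otherwise). Enriques diagram of $C$ (for $n\ge3$): the path graph with vertices $v_0,\dots,v_{n-1}$ (with $v_i$ corresponding to $P_i$) and edges $e_i=[v_{i-1}v_i]$, $1\le i\le n-1$, where each edge is decorated as curved or straight and each vertex as breaking or neutral, as follows. A straight path is a path of straight edges all of whose interior vertices are neutral; it is maximal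 if adding an adjacent edge never gives a straight path. (1) $e_i$ is curved iff $P_i$ is free. (2) If $P_{i+1},\dots,P_k$ are all the points of the sequence proximate to $P_i$ and $k\ge i+2$, then $[v_{i+1}v_k]$ is a maximal straight path, and if moreover $e_{i+1}$ is straight then $v_{i+1}$ is a breaking vertex. All other vertices are neutral. $\mathcal{E}_n$ is the set of isomorphism classes of Enriques diagrams of plane branches of blow-up complexity $n$. Always $e_1$ is curved, $e_{n-1}$ is straight and $v_0,v_1,v_{n-1}$ are neutral; a decoration with these properties is an Enriques diagram of complexity $n$ iff both edges adjacent to every breaking vertex are straight. Let $S_n=\{v_2,\dots,v_{n-2},e_2,\dots,e_{n-2}\}$ (a set of symbols). The code $\chi(\epsilon)\subseteq S_n$ of $\epsilon\in\mathcal{E}_n$ is the set of symbols in $S_n$ of the straight edges and of the breaking vertices of $\epsilon$. The staircase partial order on $\mathcal{E}_n$ is: $\epsilon\preceq\epsilon'$ iff $\chi(\epsilon)\subseteq\chi(\epsilon')$. $\alpha_n\in\mathcal{E}_n$ is the diagram with all the edges $e_2,\dots,e_{n-2}$ curved (hence $v_2,\dots,v_{n-2}$ neutral). $\omega_n\in\mathcal{E}_n$ is the diagram with all the vertices $v_2,\dots,v_{n-2}$ breaking (hence $e_2,\dots,e_{n-2}$ straight). Partially defined operators on $\mathcal{E}_n$ (decorations not mentioned are unchanged; the results are again in $\mathcal{E}_n$): - Straightening operator $s_p$ ($2\le p\le n-2$): defined on $\epsilon$ if $e_p$ is curved in $\epsilon$. $s_p(\epsilon)$ is obtained by declaring $e_p$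 straight, aligned with $e_{p-1}$ if $e_{p-1}$ is straight in $\epsilon$ (i.e. $v_{p-1}$ stays neutral), and declaring $v_p$ breaking if $e_{p+1}$ is straight. - Breaking operator $b_p$ ($2\le p\le n-2$): defined on $\epsilon$ if $[v_{p-1}v_{p+1}]$ is a straight path of $\epsilon$ (i.e. $e_p,e_{p+1}$ are straight and $v_p$ is neutral). $b_p(\epsilon)$ is obtained by declaring $v_p$ breaking. *)

(* Defs.v *)
From HB Require Import structures.
From mathcomp Require Import all_boot all_order all_algebra.
From mathcomp Require Import boolp reals.
From mathcomp Require classical_sets.
From mathcomp Require Import complex.

Set Implicit Arguments.
Unset Strict Implicit.
Unset Printing Implicit Defensive.

Import Order.TTheory GRing.Theory Num.Theory.
Local Open Scope ring_scope.

(** * Germs of analytic curves on a smooth surface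

    Local coordinates identify a smooth surface germ with (C^2, 0), and germs
    of analytic functions with convergent power series in x and y:
    [f i j] is the coefficient of x^i y^j. *)

Section Germs.
Variable R : realType.

Definition series : Type := nat -> nat -> R[i].

Implicit Types f g h u v w F : series.

Definition convergent f : Prop :=
  exists r M : R[i], 0 < r /\ forall i j, `|f i j| * r ^+ (i + j) <= M.

Definition series1 : series := fun i j => ((i == 0) && (j == 0))%N%:R.
Definition seriesX : series := fun i j => ((i == 1) && (j == 0))%N%:R.
Definition seriesY : series := fun i j => ((i == 0) && (j == 1))%N%:R.

Definition mul f g : series := fun i j =>
  \sum_(a < i.+1) \sum_(b < j.+1) f a b * g (i - a)%N (j - b)%N.

Definition pow f (k : nat) : series := iter k (mul f) series1.

Definition vanishes f : Prop := f 0%N 0%N = 0.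

(* A branch is given by an irreducible element of the ring of convergent
   series, whose units are the series with nonzero constant term.  The zero
   series is excluded, since 0 = 0 * 0. *)
Definition plane_branch f : Prop :=
  [/\ convergent f, vanishes f &
      forall g h, convergent g -> convergent h -> f = mul g h ->
        ~ vanishes g \/ ~ vanishes h].

Definition local_coordinates u v : Prop :=
  [/\ convergent u, convergent v, vanishes u, vanishes v &
      u 1%N 0%N * v 0%N 1%N - u 0%N 1%N * v 1%N 0%N != 0].

(* The support of the divisor F = 0 is a normal crossing at the origin:
   in suitable coordinates (u, v) it is empty, u = 0, v = 0 or uv = 0. *)
Definition normal_crossing F : Prop :=
  exists u v w (a b : nat),
    [/\ local_coordinates u v, convergent w, ~ vanishes w &
        F = mul w (mul (pow u a) (pow v b))].

(** * Blowing up

    The points of the exceptional curve of the blow-up of the origin are the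
    directions at the origin: [Some c] is the line y = c x, near which the
    blow-up reads (x, y) |-> (x, x (y + c)), with exceptional curve x = 0, and
    [None] is the line x = 0, near which the blow-up reads (x, y) |-> (x y, y),
    with exceptional curve y = 0. *)

Definition direction : Type := option R[i].

Implicit Types (q : direction) (d : nat -> direction).

(* f (x, x (y + c)) and f (x y, y), expanded. *)
Definition pullback q f : series :=
  match q with
  | Some c => fun i j =>
      \sum_(l < i.+1) f (i - l)%N l * c ^+ (l - j) *+ 'C(l, j)
  | None => fun i j => if (i <= j)%N then f i (j - i)%N else 0
  end.

Definition exceptional q : series := if q is Some _ then seriesX else seriesY.

(* The order of f at the origin (0 for the zero series). *)
Definition multiplicity f : nat :=
  classical_sets.xget 0%N (fun m : nat =>
    (exists i j, (i + j)%N = m /\ f i j <> 0) /\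
    (forall i j, f i j <> 0 -> (m <= i + j)%N)).

(* The pullback divided by the equation of the exceptional curve to the power
   [multiplicity f]. *)
Definition strict_transform q f : series :=
  match q with
  | Some _ => fun i j => pullback q f (i + multiplicity f)%N j
  | None => fun i j => pullback q f i (j + multiplicity f)%N
  end.

(* A sequence d of directions determines infinitely near points P_0 = O,
   P_1, P_2, etc., where P_(i+1) is the point of E(P_i) of direction d i, and
   local coordinates at each of them.  All the series below are in the
   coordinates at P_i. *)

Fixpoint total_transform f d (i : nat) : series :=
  if i is i'.+1 then pullback (d i') (total_transform f d i') else f.

(* Local equation of E(P_j) at P_(j+1+k). *)
Fixpoint exc_curve d (j k : nat) : series :=
  if k is k'.+1 then strict_transform (d (j.+1 + k')%N) (exc_curve d j k')
  else exceptional (d j).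

(* P_i is proximate to P_j: the point P_i lies on E(P_j). *)
Definition proximate d (i j : nat) : Prop :=
  (j < i)%N /\ vanishes (exc_curve d j (i - j.+1)).

Definition free_point d (i : nat) : Prop := exists! j, proximate d i j.

(* P_0, ..., P_(n-1) are the points blown up in the minimal embedded
   resolution: P_0 is blown up unless the curve is already a normal crossing,
   P_(i+1) is the unique point of E(P_i) where the total transform is not a
   normal crossing, and there is no such point on E(P_(n-1)). *)
Definition minimal_resolution f (n : nat) d : Prop :=
  (~ normal_crossing f <-> (0 < n)%N) /\
  (forall i, (i < n)%N -> forall q,
     ~ normal_crossing (pullback q (total_transform f d i)) <->
     (i.+1 < n)%N /\ q = d i).

End Germs.

(** * Decorated paths

    The vertices v_0, ..., v_(n-1) are the elements of ['I_n]; the edge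
    e_i = [v_(i-1) v_i] is represented by its index i, with 0 < i < n.  Edges
    not in [straight] are curved, vertices not in [breaking] are neutral. *)

Definition edge (n : nat) : Type := {i : 'I_n | (0 < i)%N}.
Definition edge_end n (e : edge n) : 'I_n := val e.

Record diagram (n : nat) : Type := Diagram {
  straight : {set edge n};
  breaking : {set 'I_n}
}.

Section Diagrams.
Variable n : nat.
Implicit Types (eps : diagram n) (e p : edge n) (v : 'I_n) (a b i : nat).

Definition straight_edge eps i : bool :=
  [exists e : edge n in straight eps, edge_end e == i :> nat].
Definition breaking_vertex eps i : bool :=
  [exists v : 'I_n in breaking eps, v == i :> nat].

(* The path [v_a v_b] is a straight path. *)
Definition straight_path eps a b : bool :=
  [&& (a < b < n)%N,
      [forall e : edge n, (a < edge_end e <= b)%N ==> (e \in straight eps)] &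
      [forall v : 'I_n, (a < v < b)%N ==> (v \notin breaking eps)]].

Definition maximal_straight_path eps a b : bool :=
  [&& straight_path eps a b,
      (0 < a)%N ==> ~~ straight_path eps a.-1 b &
      (b.+1 < n)%N ==> ~~ straight_path eps a b.+1].

(* P_(i+1), ..., P_k are all the points among P_0, ..., P_(n-1) that are
   proximate to P_i. *)
Definition proximate_range (R : realType) (d : nat -> direction R) (i k : nat)
    : Prop :=
  (i < k < n)%N /\
  forall j, (j < n)%N -> (proximate d j i <-> (i < j <= k)%N).

Definition diagram_of (R : realType) (d : nat -> direction R) eps : Prop :=
  [/\ forall i, (0 < i < n)%N -> (~~ straight_edge eps i <-> free_point d i),
      forall i k, proximate_range d i k -> (i.+2 <= k)%N ->
        maximal_straight_path eps i.+1 k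
    & forall m, (m < n)%N ->
        (breaking_vertex eps m <->
         exists i k, [/\ m = i.+1, proximate_range d i k, (i.+2 <= k)%N
                       & straight_edge eps i.+1])].

(* The set E_n.  Each isomorphism class is represented by its element carried
   by the standard path, which is unique, since e_1 is curved and e_(n-1)
   is straight, so that no isomorphism reverses the path. *)
Definition enriques (R : realType) eps : Prop :=
  exists (f : series R) (d : nat -> direction R),
    [/\ plane_branch f, minimal_resolution f n d & diagram_of d eps].

(** * The staircase order *)

(* The set S_n: [inl v] is a vertex symbol, [inr e] an edge symbol. *)
Definition symbols : {set 'I_n + edge n} :=
  [set s : 'I_n + edge n |
    match s with
    | inl v => (2 <= v <= n - 2)%N
    | inr e => (2 <= edge_end e <= n - 2)%N
    end].

Definition code eps : {set 'I_n + edge n} :=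
  [set s : 'I_n + edge n in symbols |
    match s with
    | inl v => v \in breaking eps
    | inr e => e \in straight eps
    end].

Definition staircase_le eps eps' : Prop := code eps \subset code eps'.
Definition staircase_lt eps eps' : Prop :=
  staircase_le eps eps' /\ eps <> eps'.

Definition is_minimum (E : diagram n -> Prop) eps : Prop :=
  E eps /\ forall eps', E eps' -> staircase_le eps eps'.
Definition is_maximum (E : diagram n -> Prop) eps : Prop :=
  E eps /\ forall eps', E eps' -> staircase_le eps' eps.

Definition alpha : diagram n :=
  Diagram [set e : edge n | edge_end e == n.-1 :> nat] set0.

Definition omega : diagram n :=
  Diagram [set e : edge n | (2 <= edge_end e)%N]
    [set v : 'I_n | (2 <= v <= n - 2)%N].

(** * Straightening and breaking operators

    They are partially defined: the value is [None] outside of the domain.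
    The index p is given as the edge e_p, whose end [edge_end p] is v_p. *)

Definition straightening_op p eps : option (diagram n) :=
  if (2 <= edge_end p <= n - 2)%N && (p \notin straight eps) then
    Some (Diagram (p |: straight eps)
            (if straight_edge eps (edge_end p).+1
             then edge_end p |: breaking eps else breaking eps))
  else None.

Definition breaking_op p eps : option (diagram n) :=
  if (2 <= edge_end p <= n - 2)%N
     && straight_path eps (edge_end p).-1 (edge_end p).+1 then
    Some (Diagram (straight eps) (edge_end p |: breaking eps))
  else None.

End Diagrams.

Arguments symbols n : clear implicits.
Arguments alpha n : clear implicits.
Arguments omega n : clear implicits.

(* Main.v *)
(* Only the fact that alpha_n and omega_n are Enriques diagrams is not purely
   combinatorial.  Both are realized by a cusp y^a = x^b: alpha_n by
   y^2 = x^(2n-3) and omega_n by two consecutive Fibonacci numbers (a, b).  At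
   every point of such a resolution the total transform is again of the form
   x^A y^B (y^a - x^b), where the pair (a, b) evolves by the subtractive
   Euclidean algorithm down to (1, 1), and the exceptional curves are
   coordinate axes, so that proximity is read off the sequence of directions.

   If a product of series vanishes on a curve (x t^a, y t^b), one of its factors
   does.  This gives irreducibility of the cusp, since a series
   vanishing on (t^a, t^b) has only terms of weight at least ab.  It also shows
   that a total transform w u^m v^k is not a normal crossing: the cusp and the
   exceptional axes would force the linear parts of u and v to be dependent. *)
From mathcomp Require Import all_boot all_order all_algebra.
From mathcomp Require Import boolp reals.
From mathcomp Require classical_sets.
From mathcomp Require Import complex.
From mathcomp Require Import zify ring.
Require Import Defs.

Set Implicit Arguments.
Unset Strict Implicit.
Unset Printing Implicit Defensive.

Import Order.TTheory GRing.Theory Num.Theory.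
Local Open Scope ring_scope.

(** * Monomial series, their pullbacks and normal crossings *)

Section Monomials.
Variable R : realType.
Implicit Types (f g F : series R) (c : R[i]).

(** By conversion [series1], [seriesX] and [seriesY] are [mono 0 0], [mono 1 0] and [mono 0 1]. *)
Definition mono (p q : nat) : series R :=
  fun i j => ((i == p) && (j == q))%N%:R.

Lemma mono_id p q : mono p q p q = 1.
Proof. by rewrite /mono !eqxx. Qed.

Lemma mono_eq0 p q i j : (i != p) || (j != q) -> mono p q i j = 0.
Proof. by rewrite /mono -negb_and => /negbTE ->. Qed.

Lemma series_eq f g : (forall i j, f i j = g i j) -> f = g.
Proof. by move=> fg; apply/funext => i; apply/funext => j. Qed.

Lemma mul_mono f p q i j :
  mul f (mono p q) i j =
  if (p <= i)%N && (q <= j)%N then f (i - p)%N (j - q)%N else 0.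
Proof.
rewrite /mul /mono; case: ifP => [/andP[pi qj]|npq].
  have hi : (i - p < i.+1)%N by lia.
  have hj : (j - q < j.+1)%N by lia.
  rewrite (bigD1 (Ordinal hi)) //= (bigD1 (Ordinal hj)) //=.
  rewrite !subKn // !eqxx mulr1 !big1 ?addr0 //.
    move=> a; rewrite -val_eqE /= => na; apply: big1 => b _.
    suff -> : (i - a == p)%N = false by rewrite mulr0.
    by have := ltn_ord a; lia.
  move=> b; rewrite -val_eqE /= => nb.
  suff -> : (j - b == q)%N = false by rewrite mulr0.
  by have := ltn_ord b; lia.
apply: big1 => a _; apply: big1 => b _.
suff -> : (i - a == p)%N && (j - b == q)%N = false by rewrite mulr0.
by lia.
Qed.

Lemma mul_mono_mono p q p' q' : mul (mono p q) (mono p' q') = mono (p + p') (q + q').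
Proof.
apply: series_eq => i j; rewrite mul_mono /mono.
by case: ifP => h; [congr (nat_of_bool _)%:R | rewrite (_ : _ && _ = false) //]; lia.
Qed.

Lemma pow_mono p q k : pow (mono p q) k = mono (k * p) (k * q).
Proof.
elim: k => // k IH.
have -> : pow (mono p q) k.+1 = mul (mono p q) (pow (mono p q) k) by [].
by rewrite IH mul_mono_mono !mulSn.
Qed.

Lemma convergent_finite f N :
  (forall i j, f i j != 0 -> (i < N)%N && (j < N)%N) -> convergent f.
Proof.
move=> fN; exists 1, (\sum_(i < N) \sum_(j < N) `|f i j|); split=> // i j.
rewrite expr1n mulr1; have [->|nz] := eqVneq (f i j) 0.
  by rewrite normr0; apply: sumr_ge0 => a _; apply: sumr_ge0.
have /andP[iN jN] := fN i j nz.
rewrite (bigD1 (Ordinal iN)) //= (bigD1 (Ordinal jN)) //= -addrA.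
by rewrite lerDl addr_ge0 //; do ?[apply: sumr_ge0 => ? _]; rewrite ?sumr_ge0.
Qed.

Lemma convergent_mono p q : convergent (mono p q).
Proof.
apply: (@convergent_finite _ (p + q).+1) => i j; rewrite /mono pnatr_eq0 eqb0 negbK.
by lia.
Qed.

(** Dividing by x^a y^b leaves a polynomial with nonzero constant term, hence a unit. *)
Lemma normal_crossing_monomial F a b N :
  (forall i j, F i j != 0 -> (i < N)%N && (j < N)%N) ->
  (forall i j, F i j != 0 -> (a <= i)%N && (b <= j)%N) ->
  F a b != 0 -> normal_crossing F.
Proof.
move=> FN Fab nz.
exists (seriesX R), (seriesY R), (fun i j => F (i + a)%N (j + b)%N), a, b; split.
- split; [exact: convergent_mono 1 0 | exact: convergent_mono 0 1 | by [] | by [] |].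
  by rewrite /seriesX /seriesY /= !mulr1 mulr0 subr0 oner_neq0.
- apply: (@convergent_finite _ N) => i j /FN; lia.
- by rewrite /vanishes !add0n; apply/eqP.
- apply: series_eq => i j.
  rewrite (_ : seriesX R = mono 1 0) // (_ : seriesY R = mono 0 1) //.
  rewrite !pow_mono !muln1 !muln0 mul_mono_mono addn0 add0n mul_mono.
  case: ifP => [/andP[ai bj]|nab]; first by rewrite !subnK.
  by apply/eqP; apply: contraFT nab; apply: Fab.
Qed.

Lemma pullback_None_mono p q : pullback None (mono p q) = mono p (p + q).
Proof.
apply: series_eq => i j; rewrite /pullback /mono.
by case: ifP => h; [congr (nat_of_bool _)%:R | rewrite (_ : _ && _ = false) //]; lia.
Qed.

(** Binomial expansion of x^(p+q) (y+c)^q. *)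
Lemma pullback_Some_mono c p q i j :
  pullback (Some c) (mono p q) i j =
  if i == (p + q)%N then c ^+ (q - j) *+ 'C(q, j) else 0.
Proof.
rewrite /pullback /mono; case: eqP => [->|ni].
  have hq : (q < (p + q).+1)%N by lia.
  rewrite (bigD1 (Ordinal hq)) //= big1 ?addr0.
    by rewrite addnK !eqxx mul1r.
  move=> l; rewrite -val_eqE /= => nl.
  by rewrite (_ : (_ == p) && _ = false) ?mul0r ?mul0rn //; lia.
apply: big1 => l _.
by rewrite (_ : (_ == p) && _ = false) ?mul0r ?mul0rn //; have := ltn_ord l; lia.
Qed.

Lemma pullback_Some0_mono p q : pullback (Some 0) (mono p q) = mono (p + q) q.
Proof.
apply: series_eq => i j; rewrite pullback_Some_mono /mono; case: eqP => //= _.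
have [ltj|ltq|->] := ltngtP j q.
- by rewrite expr0n (_ : (q - j == 0)%N = false) ?mul0rn //; lia.
- by rewrite bin_small.
- by rewrite subnn binn.
Qed.

Lemma pullbackB q f g :
  pullback q (fun i j => f i j - g i j) =
  fun i j => pullback q f i j - pullback q g i j.
Proof.
apply: series_eq => i j; case: q => [c|] /=; last by case: ifP; rewrite ?subr0.
by rewrite -sumrB; apply: eq_bigr => l _; rewrite mulrBl mulrnBl.
Qed.

(** * The series x^A y^B (y^a - x^b) *)

Definition cusp (a b A B : nat) : series R :=
  fun i j => mono A (B + a) i j - mono (A + b) B i j.

(** The factor y^a - x^b pulls back to x^a (y^a - x^(b-a)): one step of the subtractive Euclidean
    algorithm. *)
Lemma pullback_Some0_cusp a b A B : (a <= b)%N ->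
  pullback (Some 0) (cusp a b A B) = cusp a (b - a) (A + B + a) B.
Proof.
move=> ab; rewrite /cusp pullbackB !pullback_Some0_mono.
by apply: series_eq => i j; congr (mono _ _ _ _ - mono _ _ _ _); lia.
Qed.

Lemma pullback_None_cusp a b A B : (b <= a)%N ->
  pullback None (cusp a b A B) = cusp (a - b) b A (A + B + b).
Proof.
move=> ab; rewrite /cusp pullbackB !pullback_None_mono.
by apply: series_eq => i j; congr (mono _ _ _ _ - mono _ _ _ _); lia.
Qed.

Lemma mono_diff_neq0 p q p' q' i j : mono p q i j - mono p' q' i j != 0 ->
  ((i == p) && (j == q)) || ((i == p') && (j == q')).
Proof.
rewrite /mono; case: (_ && _) => //; case: (_ && _) => //.
by rewrite subr0 eqxx.
Qed.

(** One monomial divides the other; it factors out and leaves, up to sign, 1 minus a nonconstant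
    monomial, which is a unit. *)
Lemma normal_crossing_mono_diff p q p' q' :
  (p <= p')%N && (q <= q')%N || (p' <= p)%N && (q' <= q)%N ->
  (p != p') || (q != q') ->
  normal_crossing (fun i j => mono p q i j - mono p' q' i j).
Proof.
move=> le ne.
have FN : forall i j, mono p q i j - mono p' q' i j != 0 ->
    (i < (p + p' + q + q').+1)%N && (j < (p + p' + q + q').+1)%N.
  by move=> i j /mono_diff_neq0; lia.
case/orP: le => le.
  apply: (normal_crossing_monomial (a := p) (b := q) FN) => [i j /mono_diff_neq0|].
    by lia.
  by rewrite mono_id mono_eq0 ?subr0 ?oner_eq0 //; lia.
apply: (normal_crossing_monomial (a := p') (b := q') FN) => [i j /mono_diff_neq0|].
  by lia.
by rewrite mono_id mono_eq0 ?sub0r ?oppr_eq0 ?oner_eq0 //; lia.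
Qed.

Lemma pullback_Some_cusp c a b A B i j :
  pullback (Some c) (cusp a b A B) i j =
  (if i == (A + B + a)%N then c ^+ (B + a - j) *+ 'C(B + a, j) else 0) -
  (if i == (A + B + b)%N then c ^+ (B - j) *+ 'C(B, j) else 0).
Proof.
by rewrite /cusp pullbackB !pullback_Some_mono addnA (addnAC A b B).
Qed.

Lemma pullback_Some_cusp_neq0 c a b A B i j :
  pullback (Some c) (cusp a b A B) i j != 0 ->
  [&& (i == (A + B + a)%N) || (i == (A + B + b)%N) & (j <= B + a)%N].
Proof.
rewrite pullback_Some_cusp; have [lej|gtj] := leqP j (B + a).
  by rewrite andbT; do 2!case: (i =P _) => _ //; rewrite subrr eqxx.
rewrite !bin_small //; last by lia.
by rewrite !mulr0n !if_same subrr eqxx.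
Qed.

(** The pullback is x^(A+B+a) (y+c)^(B+a) - x^(A+B+b) (y+c)^B, where y+c is a unit. For distinct a
    and b the lower power of x factors out; for a = b = 1 there remains the factor y+c-1. *)
Lemma normal_crossing_pullback_Some_cusp c a b A B : c != 0 -> (a != b) ||
  (a == 1)%N && (b == 1)%N -> (0 < a)%N ->
  normal_crossing (pullback (Some c) (cusp a b A B)).
Proof.
move=> c0 ab a0.
have FN : forall i j, pullback (Some c) (cusp a b A B) i j != 0 ->
    (i < (A + B + a + b).+1)%N && (j < (A + B + a + b).+1)%N.
  by move=> i j /pullback_Some_cusp_neq0; lia.
case/orP: ab => [ab|/andP[/eqP a1 /eqP b1]].
  apply: (normal_crossing_monomial (a := A + B + minn a b) (b := 0%N) FN).
    by move=> i j /pullback_Some_cusp_neq0; lia.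
  rewrite pullback_Some_cusp !bin0 !mulr1n !subn0.
  have [ltab|ltab] : (a < b)%N \/ (b < a)%N by lia.
    have E : (A + B + a == A + B + b)%N = false by lia.
    by rewrite (minn_idPl (ltnW ltab)) eqxx E subr0 expf_neq0.
  have E : (A + B + b == A + B + a)%N = false by lia.
  by rewrite (minn_idPr (ltnW ltab)) eqxx E sub0r oppr_eq0 expf_neq0.
(* For c = 1 the strict transform is y = 0, transverse to the exceptional curve x = 0; for other c
   it misses the point. *)
subst a b; have [c1|c1] := eqVneq c 1.
  have F10 : pullback (Some c) (cusp 1 1 A B) (A + B + 1)%N 0%N = 0.
    by rewrite pullback_Some_cusp eqxx c1 !expr1n !bin0 subrr.
  apply: (normal_crossing_monomial (a := A + B + 1) (b := 1%N) FN).
    move=> i [|j] nz; have := pullback_Some_cusp_neq0 nz; last by lia.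
    move=> h; have Ei : i = (A + B + 1)%N by lia.
    by rewrite Ei F10 eqxx in nz.
  rewrite pullback_Some_cusp eqxx c1 !expr1n !bin1 addn1 mulrSr addrC addKr.
  by rewrite oner_eq0.
apply: (normal_crossing_monomial (a := A + B + 1) (b := 0%N) FN).
  by move=> i j /pullback_Some_cusp_neq0; lia.
rewrite pullback_Some_cusp eqxx !bin0 !mulr1n !subn0 addn1 exprS.
by rewrite -{2}[c ^+ B]mul1r -mulrBl mulf_neq0 ?expf_neq0 // subr_eq0.
Qed.

(** Only the direction tangent to the cusp is excluded: y = 0 if a < b, x = 0 if b < a, and none if
    a = b = 1. *)
Lemma normal_crossing_pullback_cusp q a b A B : (0 < a)%N -> (0 < b)%N ->
  [\/ (a < b)%N /\ q <> Some 0, (b < a)%N /\ q <> None | a = 1%N /\ b = 1%N] ->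
  normal_crossing (pullback q (cusp a b A B)).
Proof.
move=> a0 b0 H.
have [[c [-> c0]]|qE] : (exists c, q = Some c /\ c != 0) \/ (q = None \/ q = Some 0).
- case: q {H} => [c|]; last by right; left.
  by have [->|c0] := eqVneq c 0; [right; right | left; exists c].
- apply: normal_crossing_pullback_Some_cusp => //.
  by case: H; lia.
- case: qE => qE; rewrite qE in H *; rewrite /cusp pullbackB.
  + rewrite !pullback_None_mono; apply: normal_crossing_mono_diff.
      by case: H => [|[]|] //; lia.
    by case: H => [|[]|] //; lia.
  rewrite !pullback_Some0_mono; apply: normal_crossing_mono_diff.
    by case: H => [[]||] //; lia.
  by case: H => [[]||] //; lia.
Qed.

End Monomials.

(** * Substitution of monomial curves *)

Section Substitution.
Variables (R : realType) (x y : R[i]) (a b : nat).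
Hypotheses (a_gt0 : (0 < a)%N) (b_gt0 : (0 < b)%N).
Implicit Types (f g u v w : series R) (h : {poly {poly R[i]}}) (N k : nat).

(** The outer variable of [h] becomes x t^a and the inner one y t^b. On polynomials this is a ring
    morphism; a zero value of [x] or [y] gives a coordinate axis. *)
Definition sub_poly h : {poly R[i]} :=
  (map_poly (comp_poly (y *: 'X^b)) h).[x *: 'X^a].

Lemma sub_polyM h1 h2 : sub_poly (h1 * h2) = sub_poly h1 * sub_poly h2.
Proof. by rewrite /sub_poly rmorphM hornerM. Qed.

Lemma sub_polyB h1 h2 : sub_poly (h1 - h2) = sub_poly h1 - sub_poly h2.
Proof. by rewrite /sub_poly rmorphB hornerD hornerN. Qed.

Lemma coef_sub_poly h N k : (size h <= N)%N -> (forall i, (size (h`_i)%R <= N)%N) ->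
  (sub_poly h)`_k =
  \sum_(i < N) \sum_(j < N) (h`_i`_j * x ^+ i * y ^+ j) * (k == a * i + b * j)%N%:R.
Proof.
move=> hN hiN; rewrite /sub_poly (@horner_coef_wide _ N); last first.
  exact: leq_trans (size_poly _ _) hN.
rewrite coef_sum; apply: eq_bigr => i _; rewrite coef_map /=.
rewrite {1}/comp_poly (@horner_coef_wide _ N); last first.
  exact: leq_trans (size_poly _ _) (hiN i).
rewrite mulr_suml coef_sum; apply: eq_bigr => j _.
rewrite coef_map /= !exprZn -!exprM mul_polyC -scalerAl -!scalerAr !scalerA.
by rewrite -scalerAl scalerA -exprD coefZ coefXn addnC.
Qed.

Lemma coef_sub_poly_eq0 h k :
  (forall i j, (a * i + b * j)%N = k -> h`_i`_j = 0) -> (sub_poly h)`_k = 0.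
Proof.
move=> h0; pose N := maxn (size h) (\max_(i < size h) size (h`_i)%R).
rewrite (@coef_sub_poly h N); first last.
- move=> i; have [lti|gei] := ltnP i (size h).
    apply: leq_trans (leq_maxr _ _).
    exact: (leq_bigmax (F := fun i : 'I_(size h) => size (h`_i)%R) (Ordinal lti)).
  by rewrite nth_default // size_poly0.
- exact: leq_maxl.
apply: big1 => i _; apply: big1 => j _; case: eqP => [E|_]; last by rewrite mulr0.
by rewrite h0 ?mul0r.
Qed.

Definition trunc N f : {poly {poly R[i]}} := \poly_(i < N) \poly_(j < N) f i j.

Lemma coef_trunc N f i j :
  (trunc N f)`_i`_j = if (i < N)%N && (j < N)%N then f i j else 0.
Proof.
by rewrite coef_poly; case: (i < N)%N => /=; rewrite ?coef0 // coef_poly.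
Qed.

(* The coefficient of t^k in f (x t^a, y t^b). *)
Definition coef_on f k : R[i] := (sub_poly (trunc k.+1 f))`_k.

Lemma coef_onE f k :
  coef_on f k = \sum_(i < k.+1) \sum_(j < k.+1)
    (f i j * x ^+ i * y ^+ j) * (k == a * i + b * j)%N%:R.
Proof.
rewrite /coef_on (@coef_sub_poly _ k.+1) ?size_poly //; last first.
  by move=> i; rewrite coef_poly; case: ifP; rewrite ?size_poly ?size_poly0.
apply: eq_bigr => i _; apply: eq_bigr => j _.
by rewrite coef_trunc !ltn_ord.
Qed.

Lemma leq_weight i j k : (a * i + b * j)%N = k -> (i <= k)%N && (j <= k)%N.
Proof. by nia. Qed.

(** As [a] and [b] are positive, a monomial of weight k has both exponents at most k, so every
    truncation beyond k gives the same coefficient. *)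
Lemma coef_on_trunc N f k : (k < N)%N -> (sub_poly (trunc N f))`_k = coef_on f k.
Proof.
move=> kN; apply/eqP; rewrite -subr_eq0 -coefB -sub_polyB.
rewrite coef_sub_poly_eq0 // => i j /leq_weight/andP[ik jk].
rewrite !coefB !coef_trunc !ltnS ik jk /= !(leq_ltn_trans _ kN) //=.
by rewrite subrr.
Qed.

(** The truncated product and the product of the truncations differ only in terms of weight above
    k. *)
Lemma coef_on_mul f g k :
  coef_on (mul f g) k = \sum_(i < k.+1) coef_on f i * coef_on g (k - i).
Proof.
have -> : coef_on (mul f g) k = (sub_poly (trunc k.+1 f * trunc k.+1 g))`_k.
  apply/eqP; rewrite -subr_eq0 -coefB -sub_polyB.
  rewrite coef_sub_poly_eq0 // => i j /leq_weight/andP[ik jk].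
  rewrite !coefB coef_trunc !ltnS ik jk /= coefM coef_sum.
  apply/eqP; rewrite subr_eq0; apply/eqP; apply: eq_bigr => p _.
  rewrite coefM; apply: eq_bigr => q _.
  rewrite !coef_trunc; have hp := ltn_ord p; have hq := ltn_ord q.
  by rewrite !ifT //; lia.
rewrite sub_polyM coefM; apply: eq_bigr => i _.
by have hi := ltn_ord i; rewrite !coef_on_trunc //; lia.
Qed.

Definition vanishes_on f : Prop := forall k, coef_on f k = 0.

Lemma vanishes_on_mul f g :
  vanishes_on (mul f g) -> vanishes_on f \/ vanishes_on g.
Proof.
move=> fg0; apply: contrapT => /not_orP[].
move=> /existsNP[k0 /eqP fk0] /existsNP[l0 /eqP gl0].
have exf : exists k, coef_on f k != 0 by exists k0.
have exg : exists l, coef_on g l != 0 by exists l0.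
(* The product of the two terms of lowest order in t is nonzero and nothing cancels it. *)
case: (ex_minnP exf) => k fk kmin; case: (ex_minnP exg) => l gl lmin.
have hk : (k < (k + l).+1)%N by lia.
have := fg0 (k + l)%N; rewrite coef_on_mul (bigD1 (Ordinal hk)) //= addKn big1.
  by move/eqP; rewrite addr0 mulf_eq0 (negPf fk) (negPf gl).
move=> i; rewrite -val_eqE /= => ik; apply/eqP; rewrite mulf_eq0.
apply: contraTT ik; rewrite negb_or => /andP[fi gi].
by have := kmin _ fi; have := lmin _ gi; have := ltn_ord i; lia.
Qed.

Lemma coef_on0 f : coef_on f 0 = f 0%N 0%N.
Proof. by rewrite coef_onE !big_ord_recl !big_ord0 !muln0 /= !addr0 !mulr1. Qed.

Lemma vanishes_on_vanishes f : vanishes_on f -> vanishes f.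
Proof. by move=> /(_ 0%N); rewrite coef_on0. Qed.

Lemma vanishes_on_pow f k : vanishes_on (pow f k) -> vanishes_on f.
Proof.
elim: k => [|k IH]; last by case/(vanishes_on_mul (f := f)) => //; exact: IH.
by move=> /vanishes_on_vanishes/eqP; rewrite /vanishes /= oner_eq0.
Qed.

(** The unit [w] cannot vanish on a curve through the origin, so a power of [u] or of [v] does. *)
Lemma vanishes_on_normal_crossing u v w m k : ~ vanishes w ->
  vanishes_on (mul w (mul (pow u m) (pow v k))) -> vanishes_on u \/ vanishes_on v.
Proof.
move=> w0 /vanishes_on_mul[/vanishes_on_vanishes //|/vanishes_on_mul[]] H.
  by left; apply: vanishes_on_pow H.
by right; apply: vanishes_on_pow H.
Qed.

Lemma coef_on_mono p q k :
  coef_on (mono R p q) k = x ^+ p * y ^+ q * (k == a * p + b * q)%N%:R.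
Proof.
rewrite coef_onE; have [E|nE] := eqVneq k (a * p + b * q)%N; last first.
  rewrite mulr0; apply: big1 => i _; apply: big1 => j _.
  have [[-> ->]|ne] : (i = p :> nat /\ j = q :> nat) \/ (i != p :> nat) || (j != q :> nat).
  - by lia.
  - by rewrite (negPf nE) mulr0.
  - by rewrite mono_eq0 // !mul0r.
have /andP[pk qk] := leq_weight (esym E).
have hp : (p < k.+1)%N by []. have hq : (q < k.+1)%N by [].
rewrite (bigD1 (Ordinal hp)) //= (bigD1 (Ordinal hq)) //= mono_id -E eqxx mul1r.
rewrite !big1 ?addr0 // => i; rewrite -val_eqE /= => ne.
  by apply: big1 => j _; rewrite mono_eq0 ?ne // !mul0r.
by rewrite mono_eq0 ?ne ?orbT // !mul0r.
Qed.

Lemma coef_onB f g k :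
  coef_on (fun i j => f i j - g i j) k = coef_on f k - coef_on g k.
Proof.
rewrite !coef_onE -sumrB; apply: eq_bigr => i _.
by rewrite -sumrB; apply: eq_bigr => j _; ring.
Qed.

End Substitution.

(** * Vanishing on the cusp and on the axes *)

Section Cusp.
Variable R : realType.
Implicit Types (f : series R).

Lemma cusp_vanishes_on a b A B : (0 < a)%N -> (0 < b)%N ->
  vanishes_on 1 1 a b (cusp R a b A B).
Proof.
move=> a0 b0 k; rewrite coef_onB // !coef_on_mono // !expr1n.
by rewrite (_ : (a * A + b * (B + a))%N = (a * (A + b) + b * B)%N) ?subrr //; lia.
Qed.

(** The parameters 0, 1, 1, 1 describe the axis x = 0 as the curve (0, t). *)
Lemma cusp_vanishes_on_x a b A B : (0 < A)%N ->
  vanishes_on 0 1 1 1 (cusp R a b A B).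
Proof.
case: A => // A _ k; rewrite coef_onB // !coef_on_mono // addSn !exprS.
by rewrite !mul0r subrr.
Qed.

Lemma cusp_vanishes_on_y a b A B : (0 < B)%N ->
  vanishes_on 1 0 1 1 (cusp R a b A B).
Proof.
case: B => // B _ k; rewrite coef_onB // !coef_on_mono // addSn !exprS.
by rewrite !mul0r !mulr0 !mul0r subrr.
Qed.

(** Setting x = 0, with the convention 0^0 = 1, leaves exactly the coefficients [f 0 j]. *)
Lemma vanishes_on_x f j : vanishes_on 0 1 1 1 f -> f 0%N j = 0.
Proof.
move=> /(_ j); rewrite coef_onE // (bigD1 ord0) //= (bigD1 ord_max) //=.
rewrite muln0 mul1n add0n eqxx expr1n expr0 !mulr1 !big1 ?addr0 // => i.
  by rewrite -val_eqE /= => ni; apply: big1 => k _; rewrite expr0n (negPf ni) mulr0 !mul0r.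
rewrite -val_eqE /= => ni; case: (j =P _) => [E|_]; last by rewrite mulr0.
by exfalso; lia.
Qed.

Lemma vanishes_on_y f i : vanishes_on 1 0 1 1 f -> f i 0%N = 0.
Proof.
move=> /(_ i); rewrite coef_onE // (bigD1 ord_max) //= (bigD1 ord0) //=.
rewrite muln0 mul1n addn0 eqxx expr1n expr0 !mulr1 !big1 ?addr0 // => k.
  rewrite -val_eqE /= => nk; apply: big1 => -[[|l] hl] _ /=.
    by case: (i =P _) => [E|_]; [exfalso; lia | rewrite mulr0].
  by rewrite exprS mul0r mulr0 mul0r.
by case: k => -[|k] //= hk _; rewrite exprS mul0r mulr0 mul0r.
Qed.

(* A weight below [a * b] is attained by at most one monomial, and the weight
   [a * b] only by x^b and y^a. *)
Lemma vanishes_on_cusp f a b : (0 < a)%N -> (0 < b)%N -> coprime a b ->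
  vanishes_on 1 1 a b f ->
  (forall i j, (a * i + b * j < a * b)%N -> f i j = 0) /\ f b 0%N + f 0%N a = 0.
Proof.
move=> a0 b0 ab f0.
have weight_inj i j p q : (a * i + b * j = a * p + b * q -> a * i + b * j <= a * b ->
    i <= p -> i = p /\ j = q \/ [/\ i = 0, j = a, p = b & q = 0])%N.
  move=> E le ip; have [Eip|ltip] := eqVneq i p; first by left; nia.
  (* By coprimality p - i is a positive multiple of b, and the bound ab on the weight leaves only p
     = b and i = 0. *)
  right; have : (b %| a * (p - i))%N.
    by rewrite (_ : a * (p - i) = b * (j - q))%N ?dvdn_mulr //; nia.
  rewrite Gauss_dvdr 1?coprime_sym // => /dvdnP[[|m] Em]; first by lia.
  have Ep : p = b by nia.
  have Ei : i = 0%N by nia.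
  by split=> //; nia.
split=> [i j lt|].
  have /andP[ik jk] := @leq_weight a b a0 b0 i j _ erefl.
  have := f0 (a * i + b * j)%N; rewrite coef_onE //.
  rewrite (bigD1 (Ordinal (n := _.+1) ik)) //= (bigD1 (Ordinal (n := _.+1) jk)) //=.
  rewrite eqxx !expr1n !mulr1 !big1 ?addr0 // => [p np|q nq].
    apply: big1 => q _; case: eqP => [E|_]; last by rewrite mulr0.
    exfalso; move: np; rewrite -val_eqE /= => np.
    have [ip|pi] := leqP i p.
      by have [] := weight_inj _ _ _ _ E (ltnW lt) ip; [|case]; nia.
    rewrite E in lt.
    by have [] := weight_inj _ _ _ _ (esym E) (ltnW lt) (ltnW pi); [|case]; nia.
  case: eqP => [E|_]; last by rewrite mulr0.
  by exfalso; move: nq; rewrite -val_eqE /=; nia.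
(* The coefficient of t^(ab) reduces to [f b 0 + f 0 a]. *)
have := f0 (a * b)%N; rewrite coef_onE //.
have hb : (b < (a * b).+1)%N by nia.
have ha : (a < (a * b).+1)%N by nia.
rewrite (bigD1 (Ordinal hb)) //= (bigD1 ord0) //= muln0 addn0 eqxx !expr1n !mulr1.
rewrite big1 ?addr0 => [|q nq]; last first.
  case: eqP => [E|_]; last by rewrite mulr0.
  by exfalso; move: nq; rewrite -val_eqE /=; nia.
rewrite (bigD1 ord0) /=; last by rewrite -val_eqE /=; lia.
rewrite (bigD1 (Ordinal ha)) //= muln0 add0n (mulnC b a) eqxx !expr1n !mulr1 !big1 ?addr0 //.
  move=> p /andP[np np0]; apply: big1 => q _; case: eqP => [E|_]; last by rewrite mulr0.
  exfalso; move: np np0; rewrite -!val_eqE /= => np np0.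
  have le : (a * 0 + b * a <= a * b)%N by lia.
  by have [||] := weight_inj 0%N a p q _ le (leq0n _); [lia|lia|case]; lia.
move=> q nq; case: eqP => [E|_]; last by rewrite mulr0.
by exfalso; move: nq; rewrite -val_eqE /=; nia.
Qed.
End Cusp.

(** * Cusps: failure of normal crossing, and irreducibility *)

Section Branches.
Variable R : realType.
Implicit Types (f g u v : series R).

(** The monomials x and y have weights a and b, which are below ab once b > 1, respectively a >
    1. *)
Lemma vanishes_on_tangent u a b : (0 < a)%N -> (0 < b)%N -> coprime a b ->
  vanishes_on 1 1 a b u ->
  [/\ (1 < b)%N -> u 1%N 0%N = 0, (1 < a)%N -> u 0%N 1%N = 0 &
      u b 0%N + u 0%N a = 0].
Proof.
move=> a0 b0 ab /(vanishes_on_cusp a0 b0 ab)[low top].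
by split=> // h; apply: low; nia.
Qed.

(** In a normal crossing every component lies in u = 0 or in v = 0. The conditions on [A] and [B]
    supply the exceptional axes that a smooth curve y^a = x^b meets badly. *)
Lemma not_normal_crossing_cusp a b A B : (0 < a)%N -> (0 < b)%N -> coprime a b ->
  (a = 1%N -> (0 < B)%N) -> (b = 1%N -> (0 < A)%N) ->
  ~ normal_crossing (cusp R a b A B).
Proof.
move=> a0 b0 ab aB bA [u [v [w [m [k [[_ _ _ _ det] _ w0 E]]]]]].
have on x y c d : (0 < c)%N -> (0 < d)%N -> vanishes_on x y c d (cusp R a b A B) ->
    vanishes_on x y c d u \/ vanishes_on x y c d v.
  by move=> c0 d0; rewrite E; exact: vanishes_on_normal_crossing.
have onC := on _ _ _ _ a0 b0 (cusp_vanishes_on R A B a0 b0).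
have onY : a = 1%N -> (forall i, u i 0%N = 0) \/ (forall i, v i 0%N = 0).
  move=> /aB B0; have [//|//|H|H] := on 1 0 1%N 1%N _ _ (cusp_vanishes_on_y R a b A B0);
    by [left=> i; apply: vanishes_on_y | right=> i; apply: vanishes_on_y].
have onX : b = 1%N -> (forall i, u 0%N i = 0) \/ (forall i, v 0%N i = 0).
  move=> /bA A0; have [//|//|H|H] := on 0 1 1%N 1%N _ _ (cusp_vanishes_on_x R a b B A0);
    by [left=> i; apply: vanishes_on_x | right=> i; apply: vanishes_on_x].
move/negP: det; apply; apply/eqP.
have {}onC :
    [/\ (1 < b)%N -> u 1%N 0%N = 0, (1 < a)%N -> u 0%N 1%N = 0 &
        u b 0%N + u 0%N a = 0] \/
    [/\ (1 < b)%N -> v 1%N 0%N = 0, (1 < a)%N -> v 0%N 1%N = 0 &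
        v b 0%N + v 0%N a = 0].
  by case: onC => H; [left|right]; apply: vanishes_on_tangent.
have [a1|a1] : a = 1%N \/ (1 < a)%N by lia.
  have {}onY := onY a1; have [b1|b1] : b = 1%N \/ (1 < b)%N by lia.
    (* Three distinct lines for two coordinates: [u] or [v] vanishes on two of them and has no
       linear part. *)
    have {}onX := onX b1; subst a b.
    by case: onC => -[_ _] Eu;
      case: onY => Y; have Y1 := Y 1%N; case: onX => X; have X1 := X 1%N;
      move: Eu; rewrite ?Y1 ?X1 ?add0r ?addr0 => Eu;
      rewrite ?Eu ?Y1 ?X1 ?mulr0 ?mul0r subrr.
  (* The curve y = x^b is tangent to y = 0. If [u] and [v] contain one each, both lack the term in
     x; if one contains both, its linear part is zero. *)
  by subst a; case: onC => -[/(_ b1) U _]; case: onY => Y; have Y1 := Y 1%N; have Yb := Y b;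
    rewrite ?Yb ?add0r => V; rewrite ?U ?V ?Y1 ?mulr0 ?mul0r subrr.
have [b1|b1] : b = 1%N \/ (1 < b)%N by lia.
  have {}onX := onX b1; subst b.
  by case: onC => -[_ /(_ a1) U]; case: onX => X; have X1 := X 1%N; have Xb := X a;
    rewrite ?Xb ?addr0 => V; rewrite ?U ?V ?X1 ?mulr0 ?mul0r subrr.
(* A series vanishing on a singular cusp has no linear part. *)
by case: onC => -[/(_ b1) U /(_ a1) V _]; rewrite U V ?mulr0 ?mul0r subrr.
Qed.

Lemma mul_comm f g : mul f g = mul g f.
Proof.
apply: series_eq => i j; rewrite /mul (reindex_inj rev_ord_inj) /=.
apply: eq_bigr => p _; rewrite (reindex_inj rev_ord_inj) /=.
apply: eq_bigr => q _; rewrite mulrC !subSS !subKn //; exact: leq_ord.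
Qed.

Lemma plane_branch_cusp a b : (0 < a)%N -> (0 < b)%N -> coprime a b ->
  plane_branch (cusp R a b 0 0).
Proof.
move=> a0 b0 ab; split.
- by apply: (@convergent_finite _ _ (a + b).+1) => i j /mono_diff_neq0; lia.
- by rewrite /vanishes /cusp !mono_eq0 ?subrr //; lia.
(* Compare coefficients of x^b: in the product, the terms [g i 0] with i < b vanish by weight and
   the last one has the factor [h 0 0], whereas the cusp has -1. *)
have main g h : vanishes h -> vanishes_on 1 1 a b g -> cusp R a b 0 0 <> mul g h.
  move=> h0 /(vanishes_on_cusp a0 b0 ab)[low _] /(congr1 (fun s => s b 0%N)).
  rewrite /cusp mono_eq0 ?mono_id; last by lia.
  move=> /eqP; rewrite add0r eq_sym /mul big1 ?oppr_eq0 ?oner_eq0 //.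
    by rewrite eq_sym oppr_eq0 oner_eq0.
  move=> i _; rewrite big_ord1; have [lti|gei] := ltnP i b.
    by rewrite low ?mul0r // muln0 addn0 ltn_pmul2l.
  have -> : (b - i = 0)%N by lia.
  by rewrite h0 mulr0.
move=> g h _ _ E; apply: contrapT => /not_orP[/contrapT g0 /contrapT h0].
have := cusp_vanishes_on R 0 0 a0 b0.
rewrite E => /vanishes_on_mul[//|//|H|H]; first exact: main H E.
by rewrite mul_comm in E; exact: main H E.
Qed.

(** * Infinitely near points with monomial coordinates *)

(** In these two directions monomials pull back to monomials. *)
Definition dir (s : bool) : direction R := if s then None else Some 0.

Lemma multiplicity_mono p q : multiplicity (mono R p q) = (p + q)%N.
Proof.
rewrite /multiplicity.
have H : (exists i j, (i + j)%N = (p + q)%N /\ mono R p q i j <> 0) /\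
    (forall i j, mono R p q i j <> 0 -> (p + q <= i + j)%N).
  split; first by exists p, q; split=> //; rewrite mono_id; apply/eqP; exact: oner_neq0.
  move=> i j nz; rewrite leqNgt; apply/negP => lt; apply: nz; apply: mono_eq0; lia.
case: classical_sets.xgetP => [m _ [[i [j [<- nz]]] le]|/(_ (p + q)%N)//].
apply/eqP; rewrite eqn_leq H.2 // andbT; apply: le.
by rewrite mono_id; apply/eqP; exact: oner_neq0.
Qed.

(** An axis passes through the next point only in its own direction; otherwise its strict transform
    is 1. *)
Lemma strict_transform_mono s p q :
  strict_transform (dir s) (mono R p q) = if s then mono R p 0 else mono R 0 q.
Proof.
apply: series_eq => i j; case: s; rewrite /strict_transform /dir multiplicity_mono.
  by rewrite pullback_None_mono /mono; congr (nat_of_bool _)%:R; lia.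
by rewrite pullback_Some0_mono /mono; congr (nat_of_bool _)%:R; lia.
Qed.

(** The Boolean exponents say which axis E(P_j) is at first. It stays that axis while later
    directions differ from [s j], and is the constant 1 from the first equality on. *)
Lemma exc_curve_dir (s : nat -> bool) j k :
  exc_curve (fun i => dir (s i)) j k =
  if [forall l : 'I_k, s (j.+1 + l)%N != s j] then
    mono R (~~ s j) (s j) else mono R 0 0.
Proof.
elim: k => [|k IH].
  rewrite ifT; last by apply/forallP => -[].
  by rewrite /=; case: (s j).
rewrite [LHS]/= IH.
have -> : [forall l : 'I_k.+1, s (j.+1 + l)%N != s j] =
    [forall l : 'I_k, s (j.+1 + l)%N != s j] && (s (j.+1 + k)%N != s j).
  apply/forallP/andP => [H|[/forallP H1 H2] l].
    split; last exact: (H ord_max).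
    by apply/forallP => l; exact: (H (widen_ord (leqnSn k) l)).
  have [E|ne] := eqVneq (l : nat) k; first by rewrite E.
  have lk : (l < k)%N by have := ltn_ord l; lia.
  exact: (H1 (Ordinal lk)).
case: ifP => _ /=; rewrite strict_transform_mono ?if_same //.
by case: (s (j.+1 + k)%N); case: (s j).
Qed.

(** The direction [s l] leads from P_l to P_(l+1), hence the strict bound l < i. *)
Lemma proximate_dir (s : nat -> bool) i j :
  proximate (fun i => dir (s i)) i j <->
  (j < i)%N /\ forall l, (j < l < i)%N -> s l != s j.
Proof.
rewrite /proximate /vanishes exc_curve_dir; split=> -[ji H]; split=> //.
  move=> l /andP[jl li]; move: H; case: forallP => [H _|_ /eqP]; last first.
    by rewrite mono_id oner_eq0.
  have hl : (l - j.+1 < i - j.+1)%N by lia.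
  by have := H (Ordinal hl); rewrite /= subnKC.
rewrite ifT; first by rewrite mono_eq0 //; case: (s j).
by apply/forallP => l; apply: H; have := ltn_ord l; lia.
Qed.

(** * Branches with prescribed monomial resolution *)

(* Reversed subtractive Euclidean algorithm: [pair t k.+1] gives [pair t k] when
   the smaller entry is subtracted from the larger one, and [t k] tells which. *)
Fixpoint pair (t : nat -> bool) (k : nat) : nat * nat :=
  if k is k'.+1 then
    let: (a, b) := pair t k' in if t k' then ((a + b)%N, b) else (a, (a + b)%N)
  else (1%N, 1%N).

Lemma pair_gt0 t k : (0 < (pair t k).1)%N && (0 < (pair t k).2)%N.
Proof. by elim: k => //= k; case: (pair t k) => a b /=; case: (t k) => /=; lia. Qed.

Lemma pair_coprime t k : coprime (pair t k).1 (pair t k).2.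
Proof.
elim: k => //= k; case: (pair t k) => a b /=; case: (t k) => /=.
  by rewrite !(coprime_sym _ b) /coprime gcdnDr.
by rewrite /coprime gcdnDl.
Qed.

(** Two different steps lead from (1, 1) to (2, 3) or (3, 2), and entries never decrease
    afterwards. *)
Lemma pair_gt1 t k : t 0%N != t 1%N ->
  (1 < (pair t k.+2).1)%N && (1 < (pair t k.+2).2)%N.
Proof.
move=> t01; elim: k => [|k].
  by move: t01 => /=; case: (t 0%N); case: (t 1%N).
rewrite [pair t k.+3]/= -/(pair t k.+2); case: (pair t k.+2) => a b /=.
by case: (t k.+2) => /=; lia.
Qed.

(** The n - 1 blow-ups leading from P_0 to P_(n-1) bring the pair down to (1, 1). *)
Definition pair_series t n : series R :=
  cusp R (pair t n.-1).1 (pair t n.-1).2 0 0.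

Definition pair_dir (t : nat -> bool) n i : direction R := dir (t (n - 2 - i)%N).

(** The last two clauses are the side conditions of [not_normal_crossing_cusp]. A blow-up makes the
    exponent of the new exceptional axis positive and keeps the other exponent along with its entry
    of the pair. *)
Lemma total_transform_pair t n i : (2 < n)%N -> (i < n)%N -> t 0%N != t 1%N ->
  let p := pair t (n.-1 - i) in exists A B,
  [/\ total_transform (pair_series t n) (pair_dir t n) i = cusp R p.1 p.2 A B,
      p.1 = 1%N -> (0 < B)%N & p.2 = 1%N -> (0 < A)%N].
Proof.
move=> n2 ltin t01; elim: i ltin => [|i IH] ltin /=.
  (* At O there is no exceptional axis, but both entries exceed 1. *)
  exists 0%N, 0%N; have := pair_gt1 (n - 3) t01.
  by rewrite (_ : (n - 3).+2 = (n.-1 - 0)%N) ?subn0; [split=> //; lia | lia].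
have [A [B []]] := IH (ltnW ltin); set k := (n.-1 - i.+1)%N.
rewrite (_ : (n.-1 - i)%N = k.+1) /=; last by rewrite /k; lia.
rewrite /pair_dir (_ : (n - 2 - i)%N = k); last by rewrite /k; lia.
have := pair_gt0 t k; case: (pair t k) => a b /= /andP[a0 b0].
case: (t k) => E aB bA; rewrite {}E.
  exists A, (A + B + b)%N; rewrite pullback_None_cusp /= ?leq_addl // addnK.
  by split=> // E; lia.
exists (A + B + a)%N, B; rewrite pullback_Some0_cusp /= ?leq_addr // addKn.
by split=> // E; lia.
Qed.

Lemma minimal_resolution_pair t n : (2 < n)%N -> t 0%N != t 1%N ->
  minimal_resolution (pair_series t n) n (pair_dir t n).
Proof.
move=> n2 t01.
have bad i : (i < n)%N ->
    ~ normal_crossing (total_transform (pair_series t n) (pair_dir t n) i).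
  move=> ltin; have [A [B [-> aB bA]]] := total_transform_pair n2 ltin t01.
  have /andP[a0 b0] := pair_gt0 t (n.-1 - i).
  by apply: not_normal_crossing_cusp => //; exact: pair_coprime.
split; first by split=> _; [lia | apply: (bad 0%N); lia].
move=> i ltin q; split; last by move=> [ltSin ->]; exact: bad ltSin.
have [A [B [-> _ _]]] := total_transform_pair n2 ltin t01.
have /andP[a0 b0] := pair_gt0 t (n.-1 - i).
move=> nc; apply: contrapT => nE; apply: nc.
apply: normal_crossing_pullback_cusp => //.
(* At P_(n-1) the pair is (1, 1) and every direction is good; earlier, all directions but
   [pair_dir t n i] are. *)
have [E|ltSi] : (n.-1 - i = 0 \/ i.+1 < n)%N by lia.
  by rewrite E; constructor 3.
have {}nE : q <> pair_dir t n i by move=> Eq; apply: nE.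
move: nE; rewrite /pair_dir (_ : (n.-1 - i = (n - 2 - i).+1)%N) /=; last by lia.
have := pair_gt0 t (n - 2 - i); case: (pair t _) => a b /= /andP[a0' b0'].
by case: (t _) => /= nE; [constructor 2 | constructor 1]; split=> //; lia.
Qed.

Lemma plane_branch_pair t n : plane_branch (pair_series t n).
Proof.
have /andP[a0 b0] := pair_gt0 t n.-1.
by apply: plane_branch_cusp => //; exact: pair_coprime.
Qed.

Lemma proximate_pair_dir t n i j :
  proximate (pair_dir t n) i j <->
  (j < i)%N /\ forall l, (j < l < i)%N -> t (n - 2 - l)%N != t (n - 2 - j)%N.
Proof. exact: (proximate_dir (fun l => t (n - 2 - l)%N)). Qed.

Lemma enriques_pair n t (eps : diagram n) : (2 < n)%N -> t 0%N != t 1%N ->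
  diagram_of (pair_dir t n) eps -> enriques R eps.
Proof.
move=> n2 t01 D; exists (pair_series t n), (pair_dir t n); split=> //.
  exact: plane_branch_pair.
exact: minimal_resolution_pair.
Qed.

End Branches.

(** * The extremal diagrams *)

Section NatDiagrams.
Variables (n : nat) (S B : pred nat).

(** Predicates on plain indices reduce the checks on diagrams to arithmetic. *)
Definition nat_diagram : diagram n :=
  Diagram [set e : edge n | S (edge_end e)] [set v : 'I_n | B v].

Lemma straight_edge_nat i : straight_edge nat_diagram i = (0 < i < n)%N && S i.
Proof.
apply/existsP/andP => [[e /andP[]]|[/andP[i0 ltin] Si]].
  by rewrite inE => Se /eqP <-; rewrite Se ltn_ord (valP e).
by exists (exist _ (Ordinal ltin) i0); rewrite inE Si /=.
Qed.

Lemma breaking_vertex_nat i : breaking_vertex nat_diagram i = (i < n)%N && B i.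
Proof.
apply/existsP/andP => [[v /andP[]]|[ltin Bi]].
  by rewrite inE => Bv /eqP <-; rewrite Bv ltn_ord.
by exists (Ordinal ltin); rewrite inE Bi /=.
Qed.

Lemma straight_path_natP a b :
  reflect [/\ (a < b < n)%N, forall i, (a < i <= b)%N -> S i &
            forall i, (a < i < b)%N -> ~~ B i]
    (straight_path nat_diagram a b).
Proof.
apply: (iffP and3P) => -[ab Hs Hb]; split=> //.
- move=> i hi; have ltin : (i < n)%N by lia. have i0 : (0 < i)%N by lia.
  by have /implyP := forallP Hs (exist _ (Ordinal ltin) i0); rewrite inE; apply.
- move=> i hi; have ltin : (i < n)%N by lia.
  by have /implyP := forallP Hb (Ordinal ltin); rewrite inE; apply.
- by apply/forallP => e; apply/implyP; rewrite inE; exact: Hs.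
- by apply/forallP => v; apply/implyP; rewrite inE; exact: Hb.
Qed.

End NatDiagrams.

Lemma alphaE n : alpha n = nat_diagram n (pred1 n.-1) pred0.
Proof. by congr Diagram; apply/setP => v; rewrite !inE. Qed.

Lemma omegaE n : omega n = nat_diagram n (leq 2) (fun i => 2 <= i <= n - 2)%N.
Proof. by []. Qed.

(** * Realization of [alpha n] and [omega n] by branches *)

Section Extrema.
Variables (R : realType) (n : nat).
Hypothesis n_ge3 : (3 <= n)%N.

(** All directions are y = 0 except the one leading to P_(n-1), so that P_(n-1) is the only
    satellite point. *)
Lemma proximate_alpha i j : (i < n)%N ->
  proximate (pair_dir R (pred1 0%N) n) i j <->
  (i = j.+1 \/ i = n.-1 /\ j = n - 3)%N.
Proof.
move=> ltin; rewrite proximate_pair_dir /=; split=> [[ji H]|H].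
  have [|lt] : (i = j.+1 \/ j.+1 < i)%N by lia.
    by left.
  by right; have := H j.+1; lia.
by split=> [|l hl]; lia.
Qed.

(** The directions alternate: j + 1 differs from j, while j + 2 agrees with j and ends the proximity
    to P_j. *)
Lemma proximate_omega i j : (i < n)%N ->
  proximate (pair_dir R odd n) i j <-> (j < i <= j.+2)%N.
Proof.
move=> ltin; rewrite proximate_pair_dir /=; split=> [[ji H]|H].
  rewrite ji leqNgt; apply/negP => lt; have := H j.+2.
  rewrite (_ : n - 2 - j = (n - 2 - j.+2).+2)%N; last by lia.
  by rewrite /= negbK eqxx => /(_ _)/notF; apply; lia.
split=> [|l hl]; first by lia.
have -> : l = j.+1 by lia.
rewrite (_ : n - 2 - j = (n - 2 - j.+1).+1)%N; last by lia.
by rewrite /=; case: (odd _).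
Qed.

Lemma enriques_alpha : enriques R (alpha n).
Proof.
apply: (enriques_pair (t := pred1 0%N)) => //; rewrite alphaE.
have long i k : proximate_range n (pair_dir R (pred1 0%N) n) i k -> (i.+2 <= k)%N ->
    i = (n - 3)%N /\ k = n.-1.
  move=> [/andP[ik kn] /(_ k kn)[_]]; rewrite ik leqnn => /(_ isT).
  by rewrite proximate_alpha //; lia.
split.
- move=> i /andP[i0 ltin]; rewrite straight_edge_nat i0 ltin /=; split.
    move=> ni; exists i.-1; split=> [|j]; rewrite proximate_alpha //; lia.
  (* P_(n-1) is proximate to both P_(n-2) and P_(n-3), against uniqueness. *)
  move=> [j [_ uj]]; apply/negP => /eqP Ei.
  have := uj i.-1; have := uj (n - 3)%N; rewrite !proximate_alpha //; lia.
- move=> i k /long H /H[-> ->]; apply/and3P; split.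
  + by apply/straight_path_natP; split=> [|l /= hl|l]; rewrite /=; lia.
  (* The path [v_(n-2) v_(n-1)] cannot be extended to the left because e_(n-2) is curved. *)
  + apply/implyP => _; apply/negP => /straight_path_natP[_ /(_ (n - 2)%N) /=]; lia.
  + by apply/implyP; lia.
- move=> m ltm; rewrite breaking_vertex_nat ltm /=; split=> // -[i [k [_ /long H /H[-> _]]]].
  by rewrite straight_edge_nat /=; lia.
Qed.

Lemma enriques_omega : enriques R (omega n).
Proof.
apply: (enriques_pair (t := odd)) => //; rewrite omegaE.
have long i k : proximate_range n (pair_dir R odd n) i k -> (i.+2 <= k)%N ->
    k = i.+2 /\ (k < n)%N.
  move=> [/andP[ik kn] /(_ k kn)[_]]; rewrite ik leqnn => /(_ isT).
  by rewrite proximate_omega //; lia.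
split.
- move=> i /andP[i0 ltin]; rewrite straight_edge_nat i0 ltin /=; split.
    move=> ni; exists i.-1; split=> [|j]; rewrite proximate_omega //; lia.
  move=> [j [_ uj]]; apply/negP => ge2.
  have := uj i.-1; have := uj (i - 2)%N; rewrite !proximate_omega //; lia.
- move=> i k /long H /H[-> ltn]; apply/and3P; split.
  + by apply/straight_path_natP; split=> [|l /= hl|l]; rewrite /=; lia.
  (* On the left, either e_(i+1) = e_1 is curved or v_(i+1) is breaking. *)
  + apply/implyP => i0; apply/negP.
    by case/straight_path_natP => _ /(_ i.+1) /= A /(_ i.+1) /=; move: A; lia.
  (* On the right, v_(i+2) would become an interior vertex, and it is breaking. *)
  + apply/implyP => lt3; apply/negP.
    by case/straight_path_natP => _ _ /(_ i.+2) /=; lia.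
- move=> m ltm; rewrite breaking_vertex_nat ltm /=; split=> [hm|].
    (* The vertex v_m breaks because P_m and P_(m+1) are the points proximate to P_(m-1). *)
    exists m.-1, m.+1; split; [by lia | split; [by lia |] | by lia |].
      by move=> j ltj; rewrite proximate_omega //; lia.
    by rewrite straight_edge_nat; lia.
  move=> [i [k [-> /long H /H[Ek ltn]]]]; rewrite straight_edge_nat /=; lia.
Qed.

End Extrema.

(** * Codes of the extremal diagrams and effect of the operators *)

(** The only straight edge e_(n-1) has no symbol in S_n. *)
Lemma code_alpha n : code (alpha n) = set0.
Proof.
apply/setP => -[v|e]; rewrite !inE ?andbF //=.
by apply/negP; have := ltn_ord (edge_end e); lia.
Qed.

Lemma code_omega n : code (omega n) = symbols n.
Proof. by apply/setP => -[v|e]; rewrite !inE ?andbb //=; lia. Qed.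

Lemma code_subset n (eps eps' : diagram n) :
  straight eps \subset straight eps' -> breaking eps \subset breaking eps' ->
  staircase_le eps eps'.
Proof.
move=> /subsetP S /subsetP B; apply/subsetP => -[v|e]; rewrite !inE.
  by move=> /andP[-> /B].
by move=> /andP[-> /S].
Qed.

Lemma straightening_op_lt n p (eps eps' : diagram n) :
  straightening_op p eps = Some eps' -> staircase_lt eps eps'.
Proof.
rewrite /straightening_op; case: ifP => // /andP[_ np] [<-]; split.
  by apply: code_subset => /=; [|case: ifP => _ //]; exact: subsetUr.
by move=> E; move: np; rewrite E setU11.
Qed.

Lemma breaking_op_lt n p (eps eps' : diagram n) :
  breaking_op p eps = Some eps' -> staircase_lt eps eps'.
Proof.
rewrite /breaking_op; case: ifP => // /andP[p2 /and3P[_ _ /forallP nb]] [<-]; split.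
  by apply: code_subset => //=; exact: subsetUr.
(* As an interior vertex of the straight path [v_(p-1) v_(p+1)], v_p is neutral before the operation
   and breaking after it. *)
move=> E; have /implyP := nb (edge_end p); rewrite E setU11.
by move=> H; suff: false by []; apply: H; lia.
Qed.

Theorem proposition6p7 (R : realType) (n : nat) (hn : (3 <= n)%N) :
  (is_minimum (@enriques n R) (alpha n) /\ code (alpha n) = set0) /\
  (is_maximum (@enriques n R) (omega n) /\ code (omega n) = symbols n) /\
  (forall eps eps' : diagram n, enriques R eps -> enriques R eps' ->
     (exists p : edge n,
        straightening_op p eps = Some eps' \/ breaking_op p eps = Some eps') ->
     staircase_lt eps eps').
Proof.
split; [|split].
- split; last exact: code_alpha.
  split=> [|eps _]; first exact: enriques_alpha.
  by rewrite /staircase_le code_alpha sub0set.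
- split; last exact: code_omega.
  split=> [|eps _]; first exact: enriques_omega.
  by rewrite /staircase_le code_omega; apply/subsetP => s; rewrite inE => /andP[].
- move=> eps eps' _ _ [p [/straightening_op_lt|/breaking_op_lt]] //.
Qed.
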